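(* Let $\mathbb{S}$ be a metric space, let a sequence of measures $\{\mu_n\}_{n\ge 1}$ on $\mathbb{S}$ converge weakly to a finite measure $\mu$ on $\mathbb{S}$, and let $\{f_n\}_{n\ge 1}$ be a lower semi-equicontinuous sequence of real-valued functions on $\mathbb{S}$. All integrals appearing in this statement are assumed to be defined. Suppose that either (a) $\{f_n^-\}_{n\ge 1}$ is asymptotically uniformly integrable with respect to $\{\mu_n\}_{n\ge 1}$, or (b) there exists a sequence of measurable real-valued functions $\{g_n\}_{n\ge 1}$ on $\mathbb{S}$ such that $f_n(s)\ge g_n(s)$ for all $n\ge 1$ and $s\in\mathbb{S}$, and $$-\infty<\int_{\mathbb{S}}\limsup_{n\to\infty,\,s'\to s} g_n(s')\,\mu(ds)\le\liminf_{n\to\infty}\int_{\mathbb{S}} g_n(s)\,\mu_n(ds).$$ Then $$\int_{\mathbb{S}}\liminf_{n\to\infty} f_n(s)\,\mu(ds)\le\liminf_{n\to\infty}\int_{\mathbb{S}} f_n(s)\,\mu_n(ds).$$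
   Context: Metric spaces carry their Borel $\sigma$-field. For a function $h$, $h^+=\max\{h,0\}$ and $h^-=-\min\{h,0\}$. The integral $\int h\,d\mu$ of a measurable $[-\infty,+\infty]$-valued function is defined if $\min\{\int h^+d\mu,\int h^-d\mu\}<+\infty$, and then equals $\int h^+d\mu-\int h^-d\mu$. Weak convergence: $\{\mu_n\}$ converges weakly to a finite measure $\mu$ if $\int h\,d\mu_n\to\int h\,d\mu$ for every bounded continuous function $h$ on $\mathbb{S}$ (so $\mu_n$ is finite for all sufficiently large $n$). Lower semi-equicontinuity: $\{f_n\}$ is lower semi-equicontinuous if for each $s\in\mathbb{S}$ and each $\varepsilon>0$ there is $\delta>0$ such that $f_n(s')>f_n(s)-\varepsilon$ for all $s'\in B_\delta(s)$ (open ball) and all $n\ge 1$. Asymptotic uniform integrability: $\{h_n\}$ is asymptotically uniformly integrable with respect to $\{\mu_n\}$ if $\lim_{K\to+\infty}\limsup_{n\to\infty}\int |h_n(s)|\,\mathbf{1}\{|h_n(s)|\ge K\}\,\mu_n(ds)=0$. Double limits: $\limsup_{n\to\infty,\,s'\to s} g_n(s')=\inf_{n\ge1,\,\delta>0}\ \sup_{k\ge n,\,s'\in B_\delta(s)} g_k(s')$ (the point $s'=s$ is allowed). *)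

(* Defs.v *)
From HB Require Import structures.
From mathcomp Require Import all_boot all_order all_algebra.
From mathcomp Require Import all_classical all_reals all_analysis.
From mathcomp Require Import measurable_realfun.

Set Implicit Arguments.
Unset Strict Implicit.
Unset Printing Implicit Defensive.

Import Order.TTheory GRing.Theory Num.Theory.
Import numFieldNormedType.Exports.

Local Open Scope classical_set_scope.
Local Open Scope ring_scope.

(* The library's measurable types are pointed, so a metric space carrying a
   measure has to come with a point. *)
#[short(type="pmetricType")]
HB.structure Definition PointedMetric (K : numDomainType) :=
  {M of Metric K M & Pointed M}.

(* S with its Borel sigma-field; the carrier is convertible to S. *)
Definition borel (R : realType) (S : pmetricType R) :
    measurableType (sigma_display (@open S)) :=
  g_sigma_algebraType (@open S).

Section definitions.
Context (R : realType) (S : pmetricType R).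
Implicit Types (mu : {measure set (borel S) -> \bar R}).

(* The library integral is total, with the convention +oo - +oo = -oo; this
   predicate excludes that junk case. *)
Definition integral_defined mu (h : S -> \bar R) : Prop :=
  measurable_fun [set: borel S] (h : borel S -> \bar R) /\
  (Order.min (\int[mu]_s (h^\+ s)) (\int[mu]_s (h^\- s)) < +oo)%E.

(* The measures mu_ n need not be finite; taking h = 1 shows that they
   eventually are when mu is, so the integrals below are eventually defined. *)
Definition weak_cvg (mu_ : nat -> {measure set (borel S) -> \bar R}) mu : Prop :=
  forall h : S -> R, continuous h -> bounded_fun h ->
    (fun n => \int[mu_ n]_s (h s)%:E)%E @ \oo --> (\int[mu]_s (h s)%:E)%E.

(* Sequences are indexed from 0: term n here is term n + 1 of a sequence
   indexed by n >= 1, which changes none of the notions below. *)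
Definition lower_semi_equicontinuous (f : nat -> S -> R) : Prop :=
  forall (s : S) (e : R), 0 < e -> exists2 d : R, 0 < d &
    forall s' : S, ball s d s' -> forall n : nat, f n s - e < f n s'.

Definition asymptotically_uniformly_integrable
    (h : nat -> S -> R) (mu_ : nat -> {measure set (borel S) -> \bar R}) : Prop :=
  (fun K : R => limn_esup (fun n =>
     \int[mu_ n]_(s in [set s : borel S | (K <= `|h n s|)%R]) `|h n s|%:E)%E)
  @ +oo --> 0%E.

(* limsup of g n s' as n --> oo and s' --> s jointly, s' = s being allowed. *)
Definition joint_limsup (g : nat -> S -> R) (s : S) : \bar R :=
  ereal_inf [set ereal_sup [set (g k s')%:E | k in [set k | (n <= k)%N]
                                            & s' in ball s d]
            | n in [set: nat] & d in [set d : R | 0 < d]].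

End definitions.

(* Main.v *)
Require Import Defs.
From HB Require Import structures.
From mathcomp Require Import all_boot all_order all_algebra.
From mathcomp Require Import all_classical all_reals all_analysis.
From mathcomp Require Import measurable_realfun.
From mathcomp Require Import lra.

Set Implicit Arguments.
Unset Strict Implicit.
Unset Printing Implicit Defensive.

Import Order.TTheory GRing.Theory Num.Theory.
Import numFieldNormedType.Exports.

Local Open Scope classical_set_scope.
Local Open Scope ring_scope.

(** For h_n >= 0, let phi_n be the largest n-Lipschitz minorant of
    inf_(k >= n) min(h_k, n). The phi_n are bounded, continuous and
    nondecreasing in n, their supremum is the joint lower limit of h_k(s') as
    k --> oo and s' --> s, and phi_n <= h_k for k >= n; so weak convergence
    applied to each phi_n, followed by monotone convergence, bounds the integral
    of the joint lower limit by liminf \int h_n dmu_n. Lower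
    semi-equicontinuity makes the joint lower limit of f_n equal to the
    pointwise one. Case (a) applies this to max(f_n, -K) + K, the truncation
    error being controlled by the tail integral of f_n^-; case (b) applies it to
    f_n - g_n and uses that the joint lower limit of f_n - g_n is at least
    liminf f_n minus the joint upper limit of g_n. *)

(** * Lower limits in the extended reals, comparison of integrals, Borel measurability *)

Lemma lt_limn_einf (R : realType) (u : nat -> \bar R) (x : \bar R) :
  (x < limn_einf u)%E -> \forall n \near \oo, (x < u n)%E.
Proof.
rewrite limn_einf_lim (cvg_lim _ (@cvg_einfs_sup _ u))//.
move=> /ereal_sup_gt[_ [N _ <-] xN]; near=> n.
apply: (lt_le_trans xN); apply: ereal_inf_lbound.
by exists n => //=; near: n; exists N.
Unshelve. all: by end_near. Qed.

Lemma le_limn_einf (R : realType) (u : nat -> \bar R) (x : \bar R) :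
  (\forall n \near \oo, (x <= u n)%E) -> (x <= limn_einf u)%E.
Proof.
move=> [N _ xu]; rewrite limn_einf_lim (cvg_lim _ (@cvg_einfs_sup _ u))//.
apply: (@le_trans _ _ (einfs u N)); last by apply: ereal_sup_ubound; exists N.
by apply: le_ereal_inf_tmp => _ [k /= Nk <-]; exact: xu.
Qed.

(** A real number lies between any [y < x], so inequalities in the extended reals can be tested on
    real lower bounds, without later case splits on infinities. *)
Lemma lee_lt_fin (R : realType) (x y : \bar R) :
  (forall c : R, (c%:E < x)%E -> (c%:E <= y)%E) -> (x <= y)%E.
Proof.
move=> xy; rewrite leNgt; apply/negP => yx.
have [c /andP[yc cx]] : exists c : R, (y < c%:E < x)%E.
  case: x y yx {xy} => [x| |] [y| |] // yx.
  - exists ((x + y) / 2); move: yx; rewrite !lte_fin => yx; apply/andP; lra.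
  - by exists (x - 1); rewrite ltNyr lte_fin/=; lra.
  - by exists (y + 1); rewrite ltry lte_fin andbT; lra.
  - by exists 0; rewrite ltNyr ltry.
by have := lt_le_trans yc (xy _ cx); rewrite ltxx.
Qed.

(** From [f] to [g] positive parts increase and negative parts decrease; subtraction stays monotone
    under the convention [+oo - +oo = -oo], which settles infinite integrals too. *)
Lemma ae_le_integral d (T : measurableType d) (R : realType)
    (mu : {measure set T -> \bar R}) (f g : T -> \bar R) :
  measurable_fun setT f -> measurable_fun setT g ->
  {ae mu, forall x, (f x <= g x)%E} ->
  (\int[mu]_x f x <= \int[mu]_x g x)%E.
Proof.
move=> mf mg fg; rewrite integralE [leRHS]integralE; apply: leeB.
- apply: ae_ge0_le_integral => //; try exact: measurable_funepos.
  by apply: filterS fg => x fgx _; rewrite !funeposE ge_max !le_max fgx lexx orbT.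
- apply: ae_ge0_le_integral => //; try exact: measurable_funeneg.
  apply: filterS fg => x fgx _.
  by rewrite !funenegE ge_max !le_max leeN2 fgx lexx orbT.
Qed.

Lemma continuous_borel_measurable (R : realType) (S : pmetricType R) (h : S -> R) :
  continuous h -> measurable_fun [set: borel S] (h : borel S -> R).
Proof.
move=> /continuousP ch.
apply: (measurability _ (RGenOInfty.measurableE R)) => _ [_ [x ->] <-].
rewrite setTI; apply: sub_sigma_algebra; apply: ch.
by apply: interval_open.
Qed.

(* Pasch-Hausdorff envelope: the infimum runs over both k >= n and t, which
   avoids taking inf_(k >= n) first. *)
Definition lipreg (R : realType) (S : pmetricType R) (h : nat -> S -> R)
    (n : nat) (s : S) : R :=
  inf [set Num.min (h k t) n%:R + n%:R * mdist s t
      | k in [set k | (n <= k)%N] & t in [set: S]].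

(** * Properties of the Lipschitz envelopes *)

Lemma le_lipreg (R : realType) (S : pmetricType R) (h : nat -> S -> R) n s (c : R) :
  (forall k t, (n <= k)%N -> c <= Num.min (h k t) n%:R + n%:R * mdist s t) ->
  c <= lipreg h n s.
Proof.
move=> ch; apply: lb_le_inf => [|_ [k /= nk [t _] <-]]; last exact: ch.
by exists (Num.min (h n s) n%:R + n%:R * mdist s s), n; [exact: leqnn|exists s].
Qed.

Lemma lipreg_le (R : realType) (S : pmetricType R) (h : nat -> S -> R) n s k t :
  (forall k t, 0 <= h k t) -> (n <= k)%N ->
  lipreg h n s <= Num.min (h k t) n%:R + n%:R * mdist s t.
Proof.
move=> h0 nk; apply: ge_inf; last by exists k => //; exists t.
exists 0 => _ [j /= nj [u _] <-].
by rewrite addr_ge0 ?mulr_ge0 ?mdist_ge0// le_min h0/=.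
Qed.

Lemma lipreg_ge0 (R : realType) (S : pmetricType R) (h : nat -> S -> R) n s :
  (forall k t, 0 <= h k t) -> 0 <= lipreg h n s.
Proof.
move=> h0; apply: le_lipreg => k t nk.
by rewrite addr_ge0 ?mulr_ge0 ?mdist_ge0// le_min h0/=.
Qed.

Lemma lipreg_min (R : realType) (S : pmetricType R) (h : nat -> S -> R) n s k :
  (forall k t, 0 <= h k t) -> (n <= k)%N ->
  lipreg h n s <= Num.min (h k s) n%:R.
Proof.
by move=> h0 nk; rewrite (le_trans (lipreg_le s s h0 nk))// mdistxx mulr0 addr0.
Qed.

(** Increasing the index shrinks the range of [k] and raises both the cap and the slope. *)
Lemma lipreg_nondecreasing (R : realType) (S : pmetricType R)
    (h : nat -> S -> R) s :
  (forall k t, 0 <= h k t) -> nondecreasing_seq (lipreg h ^~ s).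
Proof.
move=> h0 m n mn; apply: le_lipreg => k t nk.
apply: (le_trans (lipreg_le s t h0 (leq_trans mn nk))).
have mnR : m%:R <= n%:R :> R by rewrite ler_nat.
by rewrite lerD ?ler_wpM2r ?mdist_ge0// le_min !ge_min lexx mnR orbT.
Qed.

(** By the triangle inequality, a competitor for [t] costs at most [n%:R * mdist s t] more as a
    competitor for [s]. *)
Lemma lipreg_lipschitz (R : realType) (S : pmetricType R)
    (h : nat -> S -> R) n s t :
  (forall k t, 0 <= h k t) ->
  lipreg h n s <= lipreg h n t + n%:R * mdist s t.
Proof.
move=> h0; rewrite -lerBlDr; apply: le_lipreg => k u nk.
rewrite lerBlDr (le_trans (lipreg_le s u h0 nk))// -addrA lerD2l -mulrDr.
by rewrite ler_wpM2l// addrC metric_triangle.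
Qed.

Lemma lipreg_continuous (R : realType) (S : pmetricType R)
    (h : nat -> S -> R) n :
  (forall k t, 0 <= h k t) -> continuous (lipreg h n).
Proof.
move=> h0 s; apply/cvgrPdist_lt => e e0.
(* Dividing by [n.+1] rather than [n] covers the slope [n = 0]. *)
have d0 : 0 < e / n.+1%:R by rewrite divr_gt0.
near=> t.
have : ball s (e / n.+1%:R) t by near: t; exact: nbhsx_ballx.
rewrite ballEmdist/= ltr_pdivlMr// => st.
have nst : n%:R * mdist s t < e.
  rewrite (le_lt_trans _ st)// mulrC ler_wpM2l ?mdist_ge0// ler_nat//.
have st1 := lipreg_lipschitz n s t h0.
have := lipreg_lipschitz n t s h0; rewrite metric_sym => st2.
rewrite ltr_norml; lra.
Unshelve. all: by end_near. Qed.

(** This makes the supremum of the envelopes dominate the joint lower limit. Take [n] at least [N],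
    [c] and [c / d]: within distance [d] of [s] the hypothesis and the cap give [c]; farther away
    the slope term alone does. *)
Lemma le_lipreg_near (R : realType) (S : pmetricType R)
    (h : nat -> S -> R) s (N : nat) (c d : R) :
  (forall k t, 0 <= h k t) -> 0 < d ->
  (forall k t, (N <= k)%N -> ball s d t -> c <= h k t) ->
  exists n, c <= lipreg h n s.
Proof.
move=> h0 d0 ch.
have [m1 cm1] : exists m : nat, c <= m%:R.
  by exists (Num.truncn c).+1; rewrite ltW// truncnS_gt.
have [m2 cm2] : exists m : nat, c / d <= m%:R.
  by exists (Num.truncn (c / d)).+1; rewrite ltW// truncnS_gt.
pose n := (N + m1 + m2)%N; exists n; apply: le_lipreg => k t nk.
have cn : c <= n%:R.
  by rewrite (le_trans cm1)// ler_nat /n -addnA addnCA leq_addr.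
have cdn : c <= n%:R * d.
  by rewrite -ler_pdivrMr// (le_trans cm2)// ler_nat leq_addl.
have [st|st] := ltP (mdist s t) d.
  rewrite -[leLHS]addr0 lerD ?mulr_ge0 ?mdist_ge0// le_min cn andbT.
  apply: ch; first by rewrite (leq_trans _ nk)// /n -addnA leq_addr.
  by rewrite ballEmdist.
rewrite -[leLHS]add0r; apply: lerD; first by rewrite le_min h0/=.
by rewrite (le_trans cdn)// ler_wpM2l.
Qed.

(** * Fatou's inequality for nonnegative functions under weak convergence *)

Lemma fatou_weak_ge0 (R : realType) (S : pmetricType R)
    (mu_ : nat -> {measure set (borel S) -> \bar R})
    (mu : {measure set (borel S) -> \bar R}) (h : nat -> S -> R) :
  weak_cvg mu_ mu -> (forall k t, 0 <= h k t) ->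
  (forall k, measurable_fun [set: borel S] (h k : borel S -> R)) ->
  (\int[mu]_s limn (fun n => (lipreg h n s)%:E) <=
   limn_einf (fun n => \int[mu_ n]_s (h n s)%:E))%E.
Proof.
move=> mucvg h0 mh.
have ml n : measurable_fun [set: borel S] (lipreg h n : borel S -> R).
  by apply: continuous_borel_measurable; exact: lipreg_continuous.
have mle n : measurable_fun setT (fun s : borel S => (lipreg h n s)%:E).
  exact/measurable_EFinP.
have le0 n (s : borel S) : [set: borel S] s -> (0 <= (lipreg h n s)%:E)%E.
  by rewrite lee_fin lipreg_ge0.
have nd_l (s : borel S) : [set: borel S] s ->
    nondecreasing_seq (fun n => (lipreg h n s)%:E).
  by move=> _ m n mn; rewrite lee_fin; exact: lipreg_nondecreasing.
rewrite (monotone_convergence mu measurableT mle le0 nd_l).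
apply: lime_le.
  apply: ereal_nondecreasing_is_cvgn => m n mn; apply: ge0_le_integral => //.
    exact: le0.
  by move=> s Ss; exact: nd_l.
apply: nearW => n; apply: lee_lt_fin => c.
have bl : bounded_fun (lipreg h n).
  exists n%:R; split=> [|M nM s _ /=]; first exact: num_real.
  rewrite ger0_norm ?lipreg_ge0// (le_trans _ (ltW nM))//.
  by rewrite (le_trans (lipreg_min s h0 (leqnn n)))// ge_min lexx orbT.
(* Weak convergence turns the [mu]-integral of the envelope into the lower limit of its
   [mu_]-integrals. *)
have [<- _] := cvg_limn_einf_sup (mucvg _ (lipreg_continuous h0) bl).
move=> /lt_limn_einf [N1 _ cN]; apply: le_limn_einf.
(* Beyond [N1] the integral of the envelope exceeds [c]; beyond [n] the envelope lies below
   [h k]. *)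
exists (maxn N1 n) => // k /=; rewrite geq_max => /andP[N1k nk].
rewrite (le_trans (ltW (cN _ N1k)))//; apply: ge0_le_integral => //.
- exact: le0.
- exact/measurable_EFinP.
- by move=> s _; rewrite lee_fin (le_trans (lipreg_min s h0 nk))// ge_min lexx.
Qed.

(** * Superadditivity of lower limits and of integrals *)

(** As [x + y] exceeds a real number, neither summand is [-oo]; the slack above [c] is halved if
    both are finite and otherwise absorbed by an infinite summand. *)
Lemma lte_addP (R : realType) (x y : \bar R) (c : R) : (c%:E < x + y)%E ->
  exists a b : R, [/\ (a%:E < x)%E, (b%:E < y)%E & c = a + b].
Proof.
case: x y => [x| |] [y| |] //; rewrite ?lte_fin => cxy.
- exists (x - (x + y - c) / 2), (y - (x + y - c) / 2).
  by rewrite !lte_fin; split; lra.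
- by exists (x - 1), (c - (x - 1)); rewrite ltry lte_fin; split=> //; lra.
- by exists (c - (y - 1)), (y - 1); rewrite ltry lte_fin; split=> //; lra.
- by exists 0, c; rewrite !ltry add0r.
Qed.

Lemma limn_einfD_le (R : realType) (u v w : nat -> \bar R) :
  (forall n, u n + v n <= w n)%E ->
  (limn_einf u + limn_einf v <= limn_einf w)%E.
Proof.
move=> uvw; apply: lee_lt_fin => c /lte_addP[a [b [/lt_limn_einf au]]].
move=> /lt_limn_einf bv ->; apply: le_limn_einf; near=> n.
by rewrite (le_trans _ (uvw n))// EFinD leeD// ltW//; near: n.
Unshelve. all: by end_near. Qed.

Lemma le_limn_einf_near (R : realType) (u v : nat -> \bar R) :
  (\forall n \near \oo, (u n <= v n)%E) -> (limn_einf u <= limn_einf v)%E.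
Proof.
move=> uv; apply: lee_lt_fin => c /lt_limn_einf cu; apply: le_limn_einf.
by apply: filterS2 cu uv => n /ltW; exact: le_trans.
Qed.

Lemma limn_esup_lt (R : realType) (u : nat -> \bar R) (x : \bar R) :
  (limn_esup u < x)%E -> \forall n \near \oo, (u n < x)%E.
Proof.
rewrite -lteN2 -limn_einfN => /lt_limn_einf; apply: filterS => n /=.
by rewrite lteN2.
Qed.

(** If [g^-] has infinite integral, the left side is [-oo]. Otherwise [f^- <= g^-] makes both
    negative parts integrable; moving them across leaves nonnegative integrands related by
    [(f - g) + g^+ + f^- = f^+ + g^-]. *)
Lemma integral_subD_le d (T : measurableType d) (R : realType)
    (mu : {measure set T -> \bar R}) (f g : T -> R) :
  measurable_fun setT f -> measurable_fun setT g -> (forall x, g x <= f x) ->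
  (\int[mu]_x (f x - g x)%:E + \int[mu]_x (g x)%:E <= \int[mu]_x (f x)%:E)%E.
Proof.
move=> mf mg gf; rewrite [X in (_ + X)%E]integralE [leRHS]integralE.
set F := (fun x => (f x)%:E); set G := (fun x => (g x)%:E).
have mF : measurable_fun setT F by exact/measurable_EFinP.
have mG : measurable_fun setT G by exact/measurable_EFinP.
have mFG : measurable_fun setT (fun x => (f x - g x)%:E).
  by apply/measurable_EFinP; exact: measurable_funB.
have [Gny|Gfin] := eqVneq (\int[mu]_x G^\- x)%E +oo%E.
  by rewrite Gny/= addeNy addeNy leNye.
have FG : (\int[mu]_x F^\- x <= \int[mu]_x G^\- x)%E.
  apply: ge0_le_integral => //; try exact: measurable_funeneg.
  by move=> x _; rewrite !funenegE ge_max !le_max leeN2 lee_fin gf lexx orbT.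
have Gf : (\int[mu]_x G^\- x)%E \is a fin_num.
  by rewrite ge0_fin_numE ?integral_ge0// ltey.
have Ff : (\int[mu]_x F^\- x)%E \is a fin_num.
  by rewrite ge0_fin_numE ?integral_ge0// (le_lt_trans FG)// ltey.
rewrite addeA leeBlDr// [leRHS]addeAC leeBrDr//.
have mFp := measurable_funepos mF; have mFn := measurable_funeneg mF.
have mGp := measurable_funepos mG; have mGn := measurable_funeneg mG.
have fg0 x : (0 <= (f x - g x)%:E)%E by rewrite lee_fin subr_ge0.
have fgG0 x : (0 <= (f x - g x)%:E + G^\+ x)%E by rewrite adde_ge0.
have mfgG : measurable_fun setT (fun x => (f x - g x)%:E + G^\+ x)%E.
  exact: emeasurable_funD.
rewrite -3?ge0_integralD//; apply: ge0_le_integral => //.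
- by move=> x _; rewrite adde_ge0.
- exact: emeasurable_funD.
- exact: emeasurable_funD.
move=> x _; rewrite !funeposE !funenegE -!EFinN -!EFin_max -!EFinD lee_fin.
have := gf x; case: (leP (f x) 0); case: (leP (g x) 0);
  case: (leP (- f x) 0); case: (leP (- g x) 0); lra.
Qed.

(** * The common core of both cases *)

(** Used with [F] the pointwise lower limit. In (b), [h] is [f - g] and [G] the joint upper limit of
    [g]; in (a), [h] is [max(f, -K) + K] and [G] the constant [-K]. The last hypothesis puts [F - G]
    below the joint lower limit of [h] wherever [G] is finite. *)
Lemma fatou_weak_minorant (R : realType) (S : pmetricType R)
    (mu_ : nat -> {measure set (borel S) -> \bar R})
    (mu : {measure set (borel S) -> \bar R}) (h : nat -> S -> R)
    (F G : S -> \bar R) :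
  weak_cvg mu_ mu -> (forall k t, 0 <= h k t) ->
  (forall k, measurable_fun [set: borel S] (h k : borel S -> R)) ->
  measurable_fun [set: borel S] (F : borel S -> \bar R) ->
  mu.-integrable [set: borel S] (G : borel S -> \bar R) ->
  (forall s, G s \is a fin_num -> forall c : R, (c%:E < F s - G s)%E ->
    exists (N : nat) (d : R), 0 < d /\
      forall k t, (N <= k)%N -> ball s d t -> c <= h k t) ->
  (\int[mu]_s F s <=
   limn_einf (fun n => \int[mu_ n]_s (h n s)%:E) + \int[mu]_s G s)%E.
Proof.
move=> mucvg h0 mh mF iG FGh.
pose U := (fun s : borel S => limn (fun n => (lipreg h n s)%:E)).
have ndl s : nondecreasing_seq (fun n => (lipreg h n s)%:E).
  by move=> m n mn; rewrite lee_fin; exact: lipreg_nondecreasing.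
have lU n s : ((lipreg h n s)%:E <= U s)%E.
  by rewrite /U (cvg_lim _ (ereal_nondecreasing_cvgn (ndl s)))//;
    apply: ereal_sup_ubound; exists n.
have U0 s : (0 <= U s)%E by rewrite (le_trans _ (lU 0 s))// lee_fin lipreg_ge0.
have mU : measurable_fun setT U.
  apply: (emeasurable_fun_cvg (fun n (s : borel S) => (lipreg h n s)%:E)).
    move=> n; apply/measurable_EFinP.
    by apply: continuous_borel_measurable; exact: lipreg_continuous.
  by move=> s _; exact: ereal_nondecreasing_is_cvgn.
have mG : measurable_fun setT (G : borel S -> \bar R) := measurable_int _ iG.
apply: (@le_trans _ _ (\int[mu]_s (U s + G s))%E).
  apply: ae_le_integral => //; first exact: emeasurable_funD.
  (* Being integrable, [G] is finite almost everywhere, so [F <= U + G] can be checked as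
     [F - G <= U]. *)
  have := integrable_ae measurableT iG; apply: filterS => s /(_ Logic.I) Gs.
  rewrite -leeBlDr//; apply: lee_lt_fin => c /(FGh _ Gs)[N [d [d0 ch]]].
  have [n cn] := le_lipreg_near h0 d0 ch.
  by rewrite (le_trans _ (lU n s))// lee_fin.
apply: (@le_trans _ _ (\int[mu]_s U s + \int[mu]_s G s)%E); last first.
  by rewrite leeD2r//; exact: fatou_weak_ge0.
(* If [U] has infinite integral, the right side is [+oo] because [G] has a finite one; otherwise the
   integral is additive. *)
have [->|Uy] := eqVneq (\int[mu]_s U s)%E +oo%E.
  have := integrable_fin_num measurableT iG; rewrite fin_numE => /andP[GNy _].
  by rewrite addye ?leey.
rewrite integralD//; apply/integrableP; split=> //.
by under eq_integral do rewrite gee0_abs//; rewrite ltey.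
Qed.

(** * Truncation error and integrability *)

(** Raising [f] to [-K] adds [(f^- - K)^+], at most [f^-] on the tail set; the shift by [K] adds the
    mass term. Since [f^-] is at most its tail plus [K], finiteness of the bound makes [f^-]
    integrable, so its integral can be moved across. *)
Lemma integral_truncD_le d (T : measurableType d) (R : realType)
    (mu : {measure set T -> \bar R}) (f : T -> R) (K : R) :
  0 <= K -> measurable_fun setT f ->
  (\int[mu]_(x in [set x | (K <= `|f^\- x|)%R]) `|f^\- x|%:E +
    K%:E * mu setT < +oo)%E ->
  (\int[mu]_x (Num.max (f x) (- K) + K)%:E <=
   \int[mu]_x (f x)%:E +
   (\int[mu]_(x in [set x | (K <= `|f^\- x|)%R]) `|f^\- x|%:E +
    K%:E * mu setT))%E.
Proof.
move=> K0 mf; set D := [set x | _]; rewrite integral_mkcond.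
set phi := (X in (\int[mu]_x X x)%E).
have mnf : measurable_fun setT (fun x => `|f^\- x|).
  by apply: measurableT_comp => //; exact: measurable_funrneg.
have mD : measurable D.
  have := mnf measurableT `[K, +oo[%classic (measurable_itv _).
  rewrite setTI (_ : _ @^-1` _ = D)//.
  by apply/seteqP; split=> x /=; rewrite in_itv/= andbT.
have mphi : measurable_fun setT phi.
  apply/(measurable_restrictT _ _).1 => //.
  by apply: measurable_funTS; exact/measurable_EFinP.
have phi0 x : (0 <= phi x)%E.
  by rewrite /phi /patch; case: ifP => // _; rewrite lee_fin.
have phiE x : phi x = (if K <= f^\- x then f^\- x else 0)%:E.
  rewrite /phi /patch (_ : (x \in D) = (K <= f^\- x)).
    by rewrite ger0_norm//; case: ifP.
  by apply/idP/idP; rewrite inE /D/= ger0_norm.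
clearbody phi.
rewrite -(@integral_cst _ _ _ mu setT)// -ge0_integralD//=.
set PK := (\int[mu]_x (phi x + K%:E))%E => PKy.
have mPK : measurable_fun setT (fun x => phi x + K%:E)%E.
  exact: emeasurable_funD.
have PK0 x : (0 <= phi x + K%:E)%E by rewrite adde_ge0.
rewrite [X in (_ <= X + _)%E]integralE.
set F := (fun x => (f x)%:E).
have mF : measurable_fun setT F by exact/measurable_EFinP.
have mFp := measurable_funepos mF; have mFn := measurable_funeneg mF.
have FnE x : F^\-%E x = (f^\- x)%:E by rewrite -[RHS]/((EFin \o _) x) -funerneg.
have FPK : (\int[mu]_x F^\- x <= PK)%E.
  apply: ge0_le_integral => // x _; rewrite FnE phiE -EFinD lee_fin.
  by case: ifPn => [|/negP/negP]; rewrite -?ltNge; lra.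
have Ff : (\int[mu]_x F^\- x)%E \is a fin_num.
  by rewrite ge0_fin_numE ?integral_ge0// (le_lt_trans FPK).
rewrite addeAC leeBrDr//.
have mh : measurable_fun setT (fun x => (Num.max (f x) (- K) + K)%:E).
  by apply/measurable_EFinP; apply: measurable_funD => //; exact: measurable_maxr.
have h0 x : (0 <= (Num.max (f x) (- K) + K)%:E)%E.
  by rewrite lee_fin; case: (leP (f x) (- K)); lra.
rewrite -2?ge0_integralD//; apply: ge0_le_integral => //.
- by move=> x _; rewrite adde_ge0.
- exact: emeasurable_funD.
- exact: emeasurable_funD.
move=> x _; rewrite FnE phiE funeposE -EFin_max -!EFinD lee_fin.
rewrite /funrneg; case: (leP (- f x) 0); case: (leP (f x) 0);
  case: (leP (f x) (- K)); case: ifPn => [|/negP/negP]; rewrite -?ltNge; lra.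
Qed.

(** A difference of nonnegative extended reals is finite only if both terms are, [+oo - +oo] being
    [-oo]. *)
Lemma integrable_of_fin_num d (T : measurableType d) (R : realType)
    (mu : {measure set T -> \bar R}) (f : T -> \bar R) :
  measurable_fun setT f -> (\int[mu]_x f x)%E \is a fin_num ->
  mu.-integrable setT f.
Proof.
move=> mf; rewrite integralE => ffin.
apply/integrableP; split => //.
rewrite (_ : (\int[mu]_x `|f x|)%E = (\int[mu]_x (f^\+ x + f^\- x))%E); last first.
  by apply: eq_integral => x _; rewrite -[LHS]/((abse \o f) x) fune_abse.
rewrite ge0_integralD//; [|exact: measurable_funepos|exact: measurable_funeneg].
have p0 : (0 <= \int[mu]_x f^\+ x)%E by exact: integral_ge0.
have n0 : (0 <= \int[mu]_x f^\- x)%E by exact: integral_ge0.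
move: p0 n0 ffin; case: (\int[mu]_x f^\+ x)%E => [a| |] //;
  case: (\int[mu]_x f^\- x)%E => [b| |] // _ _ _.
by rewrite -EFinD ltry.
Qed.

(** * Bounds uniform near a point and along a tail *)

Lemma lower_semi_equicontinuous_near (R : realType) (S : pmetricType R)
    (f : nat -> S -> R) (s : S) (c : R) :
  lower_semi_equicontinuous f ->
  (c%:E < limn_einf (fun n => (f n s)%:E))%E ->
  exists (N : nat) (d : R), 0 < d /\
    forall k t, (N <= k)%N -> ball s d t -> c < f k t.
Proof.
move=> flsec cF.
have [c' [e [c'F e0 cc']]] : exists c' e : R,
    [/\ (c'%:E < limn_einf (fun n => (f n s)%:E))%E, 0 < e & c = c' - e].
  (* Splitting [c < x + 0] yields a room [- e > 0] below the lower limit, even an infinite one. *)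
  have [c' [e [? + ->]]] := lte_addP (x := limn_einf _) (y := 0%E)
    (c := c) ltac:(by rewrite adde0; exact: cF).
  rewrite lte_fin => e0; exists c', (- e); split=> //; lra.
have [N _ c'N] := lt_limn_einf c'F.
have [d d0 fd] := flsec s e e0.
exists N, d; split=> // k t Nk st.
by have := c'N k Nk; have := fd t st k; rewrite /= lte_fin cc'; lra.
Qed.

Lemma joint_limsup_lt_near (R : realType) (S : pmetricType R)
    (g : nat -> S -> R) (s : S) (x : \bar R) :
  (joint_limsup g s < x)%E ->
  exists (N : nat) (d : R), 0 < d /\
    forall k t, (N <= k)%N -> ball s d t -> ((g k t)%:E < x)%E.
Proof.
move=> /ereal_inf_lt[_ [N _ [d /= d0 <-]] supx].
exists N, d; split=> // k t Nk st; apply: le_lt_trans supx.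
by apply: ereal_sup_ubound; exists k => //; exists t.
Qed.

(** * The two cases of the theorem *)

Lemma fatou_weak_joint_minorant (R : realType) (S : pmetricType R)
    (mu_ : nat -> {measure set (borel S) -> \bar R})
    (mu : {measure set (borel S) -> \bar R}) (f g : nat -> S -> R) :
  weak_cvg mu_ mu -> lower_semi_equicontinuous f ->
  (forall n, measurable_fun [set: borel S] (f n : borel S -> R)) ->
  (forall n, measurable_fun [set: borel S] (g n : borel S -> R)) ->
  measurable_fun [set: borel S]
    ((fun s => limn_einf (fun n => (f n s)%:E)) : borel S -> \bar R) ->
  measurable_fun [set: borel S] (joint_limsup g : borel S -> \bar R) ->
  (forall n s, g n s <= f n s) ->
  (-oo < \int[mu]_s joint_limsup g s <=
     limn_einf (fun n => \int[mu_ n]_s (g n s)%:E))%E ->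
  (\int[mu]_s limn_einf (fun n => (f n s)%:E) <=
     limn_einf (fun n => \int[mu_ n]_s (f n s)%:E))%E.
Proof.
move=> mucvg flsec mf mg mF mG gf /andP[Gny Gle].
(* If the joint upper limit has integral [+oo], so is the lower limit of the integrals of [g], and
   [g <= f] concludes. *)
have [Gy|Gfin] := eqVneq (\int[mu]_s joint_limsup g s)%E +oo%E.
  apply: le_trans (leey _) _; rewrite -Gy; apply: (le_trans Gle).
  apply: le_limn_einf_near; apply: nearW => n; apply: ae_le_integral.
  - exact/measurable_EFinP.
  - exact/measurable_EFinP.
  - by apply: aeW => s; rewrite lee_fin.
have iG : mu.-integrable [set: borel S] (joint_limsup g).
  by apply: integrable_of_fin_num => //; rewrite fin_numE gt_eqF.
apply: (@le_trans _ _ (limn_einf (fun n => \int[mu_ n]_s (f n s - g n s)%:E)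
    + \int[mu]_s joint_limsup g s)%E).
  apply: (@fatou_weak_minorant _ _ _ _ (fun n s => f n s - g n s)) => //.
  - by move=> k t; rewrite subr_ge0.
  - by move=> k; exact: measurable_funB.
  move=> s Gs c /lte_addP[a [b [aF bG ->]]].
  have [N [d [d0 fd]]] := lower_semi_equicontinuous_near flsec aF.
  (* Near [s] and for large [k], [f k > a] and [g k < - b], whence [f k - g k > a + b]. *)
  rewrite lteNr in bG.
  have [M [e [e0 ge]]] := joint_limsup_lt_near bG.
  exists (maxn N M), (Num.min d e); split; first by rewrite lt_min d0.
  move=> k t; rewrite geq_max => /andP[Nk Mk] st.
  have := fd k t Nk (le_ball (_ : Num.min d e <= d) st).
  have := ge k t Mk (le_ball (_ : Num.min d e <= e) st).
  rewrite !ge_min !lexx orbT -EFinN lte_fin => /(_ isT) + /(_ isT); lra.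
apply: (@le_trans _ _ (limn_einf (fun n => \int[mu_ n]_s (f n s - g n s)%:E)
    + limn_einf (fun n => \int[mu_ n]_s (g n s)%:E))%E).
  by rewrite leeD2l.
apply: limn_einfD_le => n; exact: integral_subD_le.
Qed.

Lemma fatou_weak_aui (R : realType) (S : pmetricType R)
    (mu_ : nat -> {measure set (borel S) -> \bar R})
    (mu : {finite_measure set (borel S) -> \bar R}) (f : nat -> S -> R) :
  weak_cvg mu_ mu -> lower_semi_equicontinuous f ->
  (forall n, measurable_fun [set: borel S] (f n : borel S -> R)) ->
  measurable_fun [set: borel S]
    ((fun s => limn_einf (fun n => (f n s)%:E)) : borel S -> \bar R) ->
  asymptotically_uniformly_integrable (fun n => (f n)^\-) mu_ ->
  (\int[mu]_s limn_einf (fun n => (f n s)%:E) <=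
     limn_einf (fun n => \int[mu_ n]_s (f n s)%:E))%E.
Proof.
move=> mucvg flsec mf mF aui; apply/lee_addgt0Pr => /= e e0.
have e2 : 0 < e / 2 by rewrite divr_gt0.
have [K [K0 Ae]] : exists K : R, 0 < K /\ \forall n \near \oo,
    (\int[mu_ n]_(s in [set s : borel S | (K <= `|(f n)^\- s|)%R])
       `|(f n)^\- s|%:E < (e / 2)%:E)%E.
  apply: (@filter_ex R (pinfty_nbhs R)).
  apply: filterI; first exact: nbhs_pinfty_gt.
  have : nbhs (0 : \bar R) [set y | (y < (e / 2)%:E)%E].
    apply: open_nbhs_nbhs.
    by split; [exact: open_ereal_lt_ereal|rewrite /= lte_fin].
  move=> /aui Alt; apply: (@filterS R (pinfty_nbhs R) _ _ _ _ Alt) => K.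
  exact: limn_esup_lt.
have muT : mu setT \is a fin_num by exact: fin_num_measure.
pose m := fine (mu setT).
have mu_le : \forall n \near \oo, (K%:E * mu_ n setT <= (K * m + e / 2)%:E)%E.
  have b1 : bounded_fun (cst 1 : S -> R).
    by exists 1; split=> [|M M1 s _ /=]; rewrite ?num_real// normr1 ltW.
  have c1 : continuous (cst 1 : S -> R) by move=> s; exact: cst_continuous.
  have := mucvg _ c1 b1.
  have int1 (nu : {measure set (borel S) -> \bar R}) :
      (\int[nu]_s (cst 1 s)%:E = nu [set: borel S])%E.
    by rewrite -[RHS]mul1e -(integral_cst nu measurableT).
  under eq_fun do rewrite int1.
  rewrite int1 => muS.
  (* Testing weak convergence on the constant 1 gives convergence of total masses; the tolerance
     [e / 2 / K] becomes [e / 2] after multiplication by [K]. *)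
  have : \forall n \near \oo, (mu_ n setT < (m + e / 2 / K)%:E)%E.
    apply: (muS [set y | (y < (m + e / 2 / K)%:E)%E]); apply: open_nbhs_nbhs.
    split; first exact: open_ereal_lt_ereal.
    by rewrite /= -(fineK muT) lte_fin ltrDl divr_gt0.
  apply: filterS => n mun.
  have K0' : (0 <= K%:E)%E by rewrite lee_fin ltW.
  apply: le_trans (lee_wpmul2l K0' (ltW mun)) _.
  rewrite -EFinM lee_fin mulrDr.
  by rewrite lerD2l mulrC divfK// gt_eqF.
have h0 k s : 0 <= Num.max (f k s) (- K) + K.
  by case: (leP (f k s) (- K)); lra.
apply: (@le_trans _ _ (limn_einf (fun n =>
    \int[mu_ n]_s (Num.max (f n s) (- K) + K)%:E) + \int[mu]_s (- K)%:E)%E).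
  apply: (fatou_weak_minorant (h := fun n s => Num.max (f n s) (- K) + K)) => //.
  - move=> k; apply: measurable_funD => //; exact: measurable_maxr.
  - exact: finite_measure_integrable_cst.
  move=> s _ c /lte_addP[a [b [aF bK ->]]].
  have [N [d [d0 fd]]] := lower_semi_equicontinuous_near flsec aF.
  exists N, d; split=> // k t Nk st.
  move: bK; rewrite -EFinN opprK lte_fin => bK.
  have := fd k t Nk st; case: (leP (f k t) (- K)); lra.
have -> : (\int[mu]_s (- K)%:E = (- K * m)%:E)%E.
  rewrite EFinM /m fineK//.
  exact: (integral_cst mu measurableT).
(* The error [e] is [e / 2] from the tail plus [e / 2] from the mass; the term [K * m] cancels
   against the integral of [- K]. *)
have : (limn_einf (fun n => \int[mu_ n]_s (Num.max (f n s) (- K) + K)%:E) <=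
    (K * m + e)%:E + limn_einf (fun n => \int[mu_ n]_s (f n s)%:E))%E.
  rewrite -limn_einf_shift//; apply: le_limn_einf_near.
  apply: filterS2 Ae mu_le => n An mun.
  have le_r : (\int[mu_ n]_(s in [set s : borel S | (K <= `|(f n)^\- s|)%R])
      `|(f n)^\- s|%:E + K%:E * mu_ n setT <= (K * m + e)%:E)%E.
    have -> : K * m + e = e / 2 + (K * m + e / 2) by lra.
    by rewrite EFinD; apply: leeD => //; exact: ltW.
  rewrite addeC (le_trans (integral_truncD_le (ltW K0) (mf n) _))//.
    by rewrite (le_lt_trans le_r)// ltry.
  by rewrite leeD2l.
move=> /(leeD2r (- K * m)%:E) /le_trans; apply.
by rewrite addeAC -EFinD addeC leeD2l// lee_fin; lra.
Qed.

Theorem corollary4p2 (R : realType) (S : pmetricType R)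
  (mu_ : nat -> {measure set (borel S) -> \bar R})
  (mu : {finite_measure set (borel S) -> \bar R})
  (f : nat -> S -> R)
  (mu_cvg : weak_cvg mu_ mu)
  (f_lsec : lower_semi_equicontinuous f)
  (f_int : forall n, integral_defined (mu_ n) (fun s => (f n s)%:E))
  (liminf_f_int :
     integral_defined mu (fun s => limn_einf (fun n => (f n s)%:E)))
  (hab : asymptotically_uniformly_integrable (fun n => (f n)^\-) mu_ \/
     exists g : nat -> S -> R,
       [/\ forall n, measurable_fun [set: borel S] (g n : borel S -> R),
           forall n s, g n s <= f n s,
           forall n, integral_defined (mu_ n) (fun s => (g n s)%:E),
           integral_defined mu (joint_limsup g) &
           (-oo < \int[mu]_s joint_limsup g s <=
              limn_einf (fun n => \int[mu_ n]_s (g n s)%:E))%E]) :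
  (\int[mu]_s limn_einf (fun n => (f n s)%:E) <=
     limn_einf (fun n => \int[mu_ n]_s (f n s)%:E))%E.
Proof.
have mf n : measurable_fun [set: borel S] (f n : borel S -> R).
  by apply/measurable_EFinP; exact: (f_int n).1.
case: hab => [aui|[g [mg gf _ [mG _] Gg]]].
  exact: fatou_weak_aui mu_cvg f_lsec mf liminf_f_int.1 aui.
exact: (fatou_weak_joint_minorant mu_cvg f_lsec mf mg liminf_f_int.1 mG gf Gg).
Qed.
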